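(* There is a constant $Q$, independent of the composition, such that the following holds. Let $f=\sigma_m\circ h_m\circ\cdots\circ\sigma_1\circ h_1$ be a standard composition defined on an interval $(a,d)$, with distortion norms $d_1\le 0$ and $d_2\ge 0$. Then for any interval $(b,c)\subset(a,d)$ with $a<b<c<d$, the distortion of $f$ on $(b,c)$ satisfies $$\mathcal{D}(f|_{(b,c)})\;\le\; Q\,d_2\,\exp(|d_1|)\,\min\!\left(1,\frac{c-b}{\min(b-a,\,d-c)}\right)+d_2+2\,\bigl|d_1+\log Cr(a,b,c,d)\bigr| .$$
   Context: Cross-ratio: $Cr(\alpha,\beta,\gamma,\delta)=\frac{(\beta-\alpha)(\delta-\gamma)}{(\gamma-\alpha)(\delta-\beta)}$. Poincaré model: for a bounded interval $I=(\alpha,\delta)$, $\mathcal{P}_{I}(\gamma)=-\log Cr(\alpha,\frac{\alpha+\delta}{2},\gamma,\delta)$ maps $I$ onto $\mathbb{R}$. For an orientation-preserving homeomorphism $\phi$ from an interval $I$ onto an interval $J$, $\mathcal{P}(\phi)=\mathcal{P}_{J}\circ\phi\circ\mathcal{P}_{I}^{-1}:\mathbb{R}\to\mathbb{R}$, and the Poincaré distortion norm is $\mathcal{D}(\phi)=\|\mathcal{P}(\phi)-\mathrm{id}\|_{C^0}=\sup_{\mathbb{R}}|\mathcal{P}(\phi)-\mathrm{id}|$. A restriction such as $f|_{(b,c)}$ is regarded as a map from $(b,c)$ onto its image. For $\phi$ defined on an interval containing $(x,y)$: $\rho(x,y;\phi)=\frac{|\phi((x,y))|}{|(x,y)|}$,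 where $|\cdot|$ is length. Standard composition on $(a,d)$: a function $f=\sigma_m\circ h_m\circ\cdots\circ\sigma_1\circ h_1$ on $(a,d)$, where all maps $h_i,\sigma_i$ are defined on intervals and are order-preserving homeomorphisms onto the domain of the next map, each $\sigma_i$ has non-negative Schwarzian derivative, and $\max_{1\le i\le m}\mathcal{D}(h_i)\le\log 2$. Put $f_0=\mathrm{id}$, $f_k=\sigma_k\circ h_k\circ\cdots\circ\sigma_1\circ h_1$ (so $h_i$ has domain $f_{i-1}((a,d))$). Its distortion norms are $$d_1=\sum_{i=1}^m\inf\left(\{0\}\cup\left\{\log\frac{\rho(\alpha,\beta;h_i)\,\rho(\gamma,\delta;h_i)}{\rho(\alpha,\delta;h_i)\,\rho(\beta,\gamma;h_i)}:\ \alpha<\beta<\gamma<\delta\in f_{i-1}((a,d))\right\}\right),\qquad d_2=\sum_{i=1}^m\mathcal{D}(h_i).$$ *)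

(* Defs.v *)
From HB Require Import structures.
From mathcomp Require Import all_boot all_order all_algebra.
From mathcomp Require Import all_classical all_reals all_analysis.
Set Implicit Arguments.
Unset Strict Implicit.
Unset Printing Implicit Defensive.
Import Order.TTheory GRing.Theory Num.Theory.
Import numFieldNormedType.Exports.
Local Open Scope classical_set_scope.
Local Open Scope ring_scope.

Section StandardCompositions.
Context {R : realType}.
Implicit Types (I J : set R) (phi f : R -> R) (h s : nat -> R -> R).

Definition Cr (al be ga de : R) : R :=
  ((be - al) * (de - ga)) / ((ga - al) * (de - be)).

(* The endpoints of a bounded interval [I] are [inf I] and [sup I]; the
   definitions below are meaningful only when [I] is a bounded interval. *)
Definition ilength I : R := sup I - inf I.

Definition poincare_model I (ga : R) : R :=
  - ln (Cr (inf I) ((inf I + sup I) / 2) ga (sup I)).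

Definition poincare I J phi : R -> R :=
  poincare_model J \o phi \o pinv I (poincare_model I).

(* [phi] is regarded as a map from [I] onto its image.  The supremum may be
   [+oo]. *)
Definition distortion I phi : \bar R :=
  ereal_sup [set (`|poincare I (phi @` I) phi t - t|)%:E | t in [set: R]].

Definition rho (x y : R) phi : R :=
  ilength (phi @` `]x, y[) / ilength `]x, y[.

Definition increasing_homeo I J phi : Prop :=
  [/\ set_bij I J phi,
      {in I &, {homo phi : x y / x < y}},
      {within I, continuous phi} &
      {within J, continuous (pinv I phi)}].

Definition schwarzian phi (x : R) : R :=
  derive1n 3 phi x / derive1 phi x
  - 3 / 2 * (derive1n 2 phi x / derive1 phi x) ^+ 2.

Definition nonneg_schwarzian I phi : Prop :=
  forall x, I x ->
    [/\ forall k, (k < 3)%N -> derivable (derive1n k phi) x 1,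
        derive1 phi x != 0 &
        0 <= schwarzian phi x].

(* The maps are indexed from 0: [h i] and [s i] stand for h_{i+1} and
   sigma_{i+1}.  They are total functions, whose values matter only on the
   intervals [hdom] and [sdom]. *)
Fixpoint comp_upto h s (k : nat) : R -> R :=
  if k is k'.+1 then s k' \o h k' \o comp_upto h s k' else id.

Definition hdom (a d : R) h s (i : nat) : set R :=
  comp_upto h s i @` `]a, d[.

Definition sdom (a d : R) h s (i : nat) : set R := h i @` hdom a d h s i.

(* The Poincare distortion of [h i] only makes sense between bounded
   intervals.  The image of the last map is allowed to be unbounded. *)
Definition standard_composition (m : nat) (a d : R) h s : Prop :=
  forall i, (i < m)%N ->
    [/\ bounded_set (hdom a d h s i) /\ bounded_set (sdom a d h s i),
        increasing_homeo (hdom a d h s i) (sdom a d h s i) (h i),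
        increasing_homeo (sdom a d h s i) (hdom a d h s i.+1) (s i),
        nonneg_schwarzian (sdom a d h s i) (s i) &
        (distortion (hdom a d h s i) (h i) <= (ln 2)%:E)%E].

Definition cross_ratio_distortions I phi : set (\bar R) :=
  [set e | exists al be ga de : R,
    [/\ I al, I be, I ga & I de] /\ [/\ al < be, be < ga & ga < de] /\
    e = (ln ((rho al be phi * rho ga de phi) /
             (rho al de phi * rho be ga phi)))%:E].

(* Each infimum, hence [d1], may be [-oo]. *)
Definition d1 (m : nat) (a d : R) h s : \bar R :=
  (\sum_(i < m) ereal_inf
     ([set 0] `|` cross_ratio_distortions (hdom a d h s i) (h i)))%E.

Definition d2 (m : nat) (a d : R) h s : \bar R :=
  (\sum_(i < m) distortion (hdom a d h s i) (h i))%E.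

Lemma d1_le0 m a d h s : (d1 m a d h s <= 0)%E.
Proof. by apply: sume_le0 => i _; apply: ereal_inf_lbound; left. Qed.

Lemma d2_ge0 m a d h s : (0 <= d2 m a d h s)%E.
Proof.
apply: sume_ge0 => i _; apply: le_trans (ereal_sup_ubound _); last by exists 0.
by rewrite lee_fin.
Qed.

End StandardCompositions.

(* Main.v *)
Require Import Defs.
From HB Require Import structures.
From mathcomp Require Import all_boot all_order all_algebra.
From mathcomp Require Import all_classical all_reals all_analysis.
From mathcomp Require Import ring lra.
Set Implicit Arguments.
Unset Strict Implicit.
Unset Printing Implicit Defensive.
Import Order.TTheory GRing.Theory Num.Theory.
Import numFieldNormedType.Exports.
Local Open Scope classical_set_scope.
Local Open Scope ring_scope.

(** The two cross-ratios of four points al < be < ga < de are tied together.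
With L, M, R, T the lengths of (al,be), (be,ga), (ga,de), (al,de), put
X = LR/(MT); since (L+M)(M+R) = LR + MT, one has Cr = X/(1+X).

- A map with non-negative Schwarzian derivative does not decrease X
  ([nonneg_schwarzian_sideCr_le]), and h_i multiplies X by at least the
  exponential of its summand of d1, by definition of that summand
  ([sideCr_ge_distortion]).  Hence f multiplies X by at least exp d1
  ([sideCr_ge_comp_upto]).

- In Poincare coordinates, the displacement of x in (b,c) under f is the
  logarithm of rho(b,x)/rho(x,c).  The distortion of X on (b,x,c,d') bounds
  it below by d1 + log (rho(b,d')/rho(c,d')), and its distortion on (a',b,x,c)
  bounds it above by - d1 + log (rho(a',b)/rho(a',c)).  Those two
  ratios of rho are controlled by the positions of the points alone, because
  the image of an interval is longer than that of a subinterval: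
  rho(b,d')/rho(c,d') >= (d'-c)/(d'-b) and
  rho(a',b)/rho(a',c) <= (c-a')/(b-a').

So the displacement has absolute value at most |d1 + log Cr(a,b,c,d)|
([distortion_le_of_sideCr]), and the constant Q = 0 works.  The points a' in
(a,b) and d' in (c,d) replace a and d because the distortion of X is only
available inside (a,d); Cr(a,b,c,d) is strictly smaller than (d-c)/(d-b) and
(b-a)/(c-a), which leaves room for them. *)

(** * Non-negative Schwarzian derivative and cross-ratios *)

Section NonnegSchwarzian.
Context {R : realType}.
Implicit Types (x y t : R) (f g : R -> R).

(** The cross-ratio LR/(MT) whose distortion enters [d1]: the two side
intervals against the middle one and the whole. *)
Definition sideCr (al be ga de : R) : R :=
  ((be - al) * (de - ga)) / ((de - al) * (ga - be)).

Lemma nondecreasing_of_derive f g x y : x <= y ->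
  (forall t, x <= t <= y -> is_derive t 1 f (g t)) ->
  (forall t, x <= t <= y -> 0 <= g t) -> f x <= f y.
Proof.
move=> xy df g0.
have dfo t : t \in `]x, y[ -> is_derive t 1 f (g t).
  by move=> /subset_itv_oo_cc; rewrite in_itv /=; exact: df.
have cf : {within `[x, y], continuous f}.
  apply: derivable_within_continuous => t; rewrite in_itv /= => /df dft.
  exact: ex_derive.
have [t + fxy] := MVT_segment xy dfo cf.
rewrite in_itv /= => /g0 gt0.
by rewrite -subr_ge0 fxy mulr_ge0// subr_ge0.
Qed.

(** The power g^k of a positive function g.  Unlike [powR], it makes no
exception at the value 0, so that the chain rule applies to it directly. *)
Definition exp_power (g : R -> R) (k : R) : R -> R :=
  expR \o (cst k * (@ln R \o g)).

Section Derivatives.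
Variables (p q : R) (f f1 f2 f3 : R -> R).
Hypothesis df : forall t, p < t < q -> is_derive t 1 f (f1 t).
Hypothesis df1 : forall t, p < t < q -> is_derive t 1 f1 (f2 t).
Hypothesis df2 : forall t, p < t < q -> is_derive t 1 f2 (f3 t).
Hypothesis f1_gt0 : forall t, p < t < q -> 0 < f1 t.
Hypothesis schwarz_ge0 : forall t, p < t < q ->
  0 <= f3 t / f1 t - 3 / 2 * (f2 t / f1 t) ^+ 2.

Local Notation u := (exp_power f1).

Let du k t : p < t < q -> is_derive t 1 (u k) (u k t * (k * (f2 t / f1 t))).
Proof.
move=> ptq; have f1t := f1_gt0 ptq; have ? := df1 ptq.
have dl : is_derive t 1 (@ln R \o f1) ((f1 t)^-1 * f2 t).
  by apply: is_derive1_comp; exact: is_derive1_ln.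
have dk : is_derive t 1 (cst k * (@ln R \o f1)) (k * (f2 t / f1 t)).
  by apply: is_derive_eq; rewrite /GRing.scale /= mulr0 addr0 (mulrC _^-1).
by apply: is_derive1_comp; exact: is_derive_expR.
Qed.

(* With v = f1^(-1/2) one has v' = - v f2 / (2 f1), the function below, and
   v'' = - (Schwarzian of f) v / 2. *)
Let du' t : p < t < q -> is_derive t 1
  (u (- 2^-1) * (cst (- 2^-1) * (f2 * (fun s => (f1 s)^-1))))
  (- 2^-1 * u (- 2^-1) t * (f3 t / f1 t - 3 / 2 * (f2 t / f1 t) ^+ 2)).
Proof.
move=> ptq; have f1t : f1 t != 0 by rewrite gt_eqF// f1_gt0.
have ? := df1 ptq; have ? := df2 ptq; have ? := du (- 2^-1) ptq.
have ? := is_deriveV f1t (df1 ptq).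
apply: is_derive_eq; rewrite /GRing.scale /=.
by rewrite !fctE; field.
Qed.

Let u_gt0 k t : 0 < u k t.
Proof. exact: expR_gt0. Qed.

Let uD k l t : u k t * u l t = u (k + l) t.
Proof. by rewrite /exp_power /= -expRD; congr expR; rewrite !fctE mulrDl. Qed.

Let u0 t : u 0 t = 1.
Proof. by rewrite /exp_power /= fctE mul0r expR0. Qed.

Let u1 t : p < t < q -> u 1 t = f1 t.
Proof. by move=> ptq; rewrite /exp_power /= fctE mul1r lnK// posrE f1_gt0. Qed.

(** A non-negative Schwarzian derivative of f makes f'^(-1/2) concave, so this
function lies below its tangent at y. *)
Lemma inv_sqrt_derivative_below_tangent x y : p < x -> x <= y -> y < q ->
  u (- 2^-1) x <=
  u (- 2^-1) y - (y - x) * (u (- 2^-1) y * (- 2^-1 * (f2 y / f1 y))).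
Proof.
move=> px xy yq; set v := fun t => u (- 2^-1) t * (- 2^-1 * (f2 t / f1 t)).
have in_pq t : x <= t <= y -> p < t < q.
  by case/andP=> xt ty; rewrite (lt_le_trans px xt) (le_lt_trans ty yq).
have v_dec t : x <= t <= y -> v y <= v t.
  move=> /andP[xt ty]; rewrite -lerN2 -[- v t]/((- v) t) -[- v y]/((- v) y).
  apply: (@nondecreasing_of_derive (- v) (fun s => 2^-1 * u (- 2^-1) s *
    (f3 s / f1 s - 3 / 2 * (f2 s / f1 s) ^+ 2))); first exact: ty.
    move=> s /andP[ts sy].
    have /in_pq/du' d : x <= s <= y by rewrite (le_trans xt ts).
    by apply: is_derive_eq; rewrite -!mulNr opprK.
  move=> s /andP[ts sy].
  have /in_pq/schwarz_ge0 S0 : x <= s <= y by rewrite (le_trans xt ts).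
  by rewrite mulr_ge0// mulr_ge0// ltW// u_gt0.
pose h := u (- 2^-1) - cst (v y) * id.
suff : h x <= h y.
  have hE t : h t = u (- 2^-1) t - v y * t by [].
  by rewrite !hE /v; lra.
apply: (@nondecreasing_of_derive h (fun t => v t - v y)); first exact: xy.
  move=> t /in_pq ptq; have ? := du (- 2^-1) ptq.
  by apply: is_derive_eq; rewrite /GRing.scale /= /v mulr0 addr0 mulr1.
by move=> t /v_dec; rewrite subr_ge0.
Qed.

(** Differentiating (t - x) f'(x)^(1/2) f'(t)^(1/2) - (f t - f x) in t gives,
up to a positive factor, the gap between the concave function f'^(-1/2) and
its tangent line at t, evaluated at x. *)
Lemma increment_le_derivatives x y : p < x -> x < y -> y < q ->
  f y - f x <= (y - x) * (u 2^-1 x * u 2^-1 y).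
Proof.
move=> px xy yq.
have in_pq t : x <= t <= y -> p < t < q.
  by case/andP=> xt ty; rewrite (lt_le_trans px xt) (le_lt_trans ty yq).
pose W := (id - cst x) * (cst (u 2^-1 x) * u 2^-1) - f.
suff : W x <= W y.
  have WE t : W t = (t - x) * (u 2^-1 x * u 2^-1 t) - f t by [].
  by rewrite !WE; lra.
apply: (@nondecreasing_of_derive W (fun t => u 2^-1 x *
   (u 2^-1 t + (t - x) * (u 2^-1 t * (2^-1 * (f2 t / f1 t)))) - f1 t)).
- exact: ltW.
- move=> t /in_pq ptq; have ? := du 2^-1 ptq; have ? := df ptq.
  by apply: is_derive_eq; rewrite /GRing.scale /= !fctE; ring.
move=> t /[dup] /in_pq ptq /andP[xt ty].
have ux : u (- 2^-1) x * u 2^-1 x = 1 by rewrite uD addNr u0.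
have ut : u (- 2^-1) t * u 2^-1 t = 1 by rewrite uD addNr u0.
have f1t : f1 t = u 2^-1 t * u 2^-1 t.
  by rewrite uD (_ : 2^-1 + 2^-1 = 1) ?u1//; field.
rewrite [X in _ - X]f1t.
have := inv_sqrt_derivative_below_tangent px xt (le_lt_trans ty yq).
have := u_gt0 2^-1 x; have := u_gt0 2^-1 t.
move: ux ut; move: (u (- 2^-1) x) (u (- 2^-1) t) (u 2^-1 x) (u 2^-1 t).
move: (f2 t / f1 t).
move=> n vx vt wx wt vwx vwt wt0 wx0.
rewrite -subr_ge0 => H.
have -> : wx * (wt + (t - x) * (wt * (2^-1 * n))) - wt * wt =
   (vt - (t - x) * (vt * (- 2^-1 * n)) - vx) * (wx * wt ^+ 2).
  transitivity (wx * wt * (vt * wt)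
    + (t - x) * (2^-1 * n * wx * wt) * (vt * wt) - (vx * wx) * wt ^+ 2).
    by rewrite vwx vwt; ring.
  by ring.
by rewrite mulr_ge0 // mulr_ge0 ?sqr_ge0// ltW.
Qed.

Hypothesis f_incr : forall x y, p < x -> x < y -> y < q -> f x < f y.

Lemma increment_sqr_le x y : p < x -> x < y -> y < q ->
  ((f y - f x) / (y - x)) ^+ 2 <= f1 x * f1 y.
Proof.
move=> px xy yq.
have f1E t : p < t < q -> f1 t = u 2^-1 t ^+ 2.
  by move=> ptq; rewrite expr2 uD (_ : 2^-1 + 2^-1 = 1) ?u1//; field.
have pxq : p < x < q by rewrite px (lt_trans xy).
have pyq : p < y < q by rewrite yq (lt_trans px).
rewrite (f1E x pxq) (f1E y pyq) -exprMn.
have fxy0 : 0 <= (f y - f x) / (y - x).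
  by rewrite ltW// divr_gt0 ?subr_gt0// f_incr.
have uxy0 : 0 <= u 2^-1 x * u 2^-1 y by rewrite ltW// mulr_gt0.
rewrite lerXn2r ?nnegrE// ler_pdivrMr ?subr_gt0// mulrC.
exact: increment_le_derivatives.
Qed.

(** The derivative in x1 of the left-hand side is
f'(x1) f'(y) / (f y - f x1)^2 - 1 / (y - x1)^2, which is non-negative by
[increment_sqr_le]. It is also the mixed second derivative of
log ((f y - f x1) / (y - x1)). *)
Lemma poincare_density_nondecreasing x1 x2 y :
  p < x1 -> x1 <= x2 -> x2 < y -> y < q ->
  f1 y / (f y - f x1) - (y - x1)^-1 <= f1 y / (f y - f x2) - (y - x2)^-1.
Proof.
move=> px1 x12 x2y yq.
pose G := cst (f1 y) * (fun t => ((cst (f y) - f) t)^-1)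
          - (fun t => ((cst y - id) t)^-1).
suff : G x1 <= G x2 by [].
have in_pq t : x1 <= t <= x2 -> [/\ p < t, t < y & p < t < q].
  move=> /andP[xt tx]; rewrite (lt_le_trans px1 xt) (le_lt_trans tx x2y).
  by rewrite (lt_trans (le_lt_trans tx x2y) yq).
apply: (@nondecreasing_of_derive G
  (fun t => f1 t * f1 y / (f y - f t) ^+ 2 - (y - t) ^- 2)); first exact: x12.
- move=> t /in_pq[pt ty ptq].
  have yt0 : y - t != 0 by rewrite subr_eq0 gt_eqF.
  have fyt0 : f y - f t != 0 by rewrite subr_eq0 gt_eqF// f_incr.
  have ? := df ptq.
  have dyf : is_derive t 1 (cst (f y) - f) (- f1 t).
    by apply: is_derive_eq; rewrite sub0r.
  have dy : is_derive t 1 (cst y - id) (- 1 : R).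
    by apply: is_derive_eq; rewrite sub0r.
  have ? := is_deriveV (f := cst (f y) - f) fyt0 dyf.
  have ? := is_deriveV (f := cst y - id) yt0 dy.
  apply: is_derive_eq; rewrite /GRing.scale /= !fctE.
  by field; rewrite yt0 fyt0.
- move=> t /in_pq[pt ty ptq].
  have yt0 : 0 < y - t by rewrite subr_gt0.
  have fyt0 : 0 < f y - f t by rewrite subr_gt0 f_incr.
  rewrite subr_ge0 ler_pdivlMr ?exprn_gt0//.
  by rewrite mulrC -expr_div_n increment_sqr_le.
Qed.

(** The logarithmic derivative in y of rho(be,y) / rho(al,y) is the difference
of the two sides of [poincare_density_nondecreasing], at be and at al. *)
Lemma increment_ratio_nondecreasing al be ga de :
  p < al -> al < be -> be < ga -> ga <= de -> de < q ->
  (f ga - f be) / (ga - be) * ((ga - al) / (f ga - f al)) <=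
  (f de - f be) / (de - be) * ((de - al) / (f de - f al)).
Proof.
move=> pal albe bega gade deq.
have in_pq t : ga <= t <= de -> [/\ be < t, al < t, t < q & p < t < q].
  move=> /andP[gt td]; have bt := lt_le_trans bega gt.
  have alt := lt_trans albe bt; have tq := le_lt_trans td deq.
  by rewrite (lt_trans pal alt).
have pbe := lt_trans pal albe.
have incr_gt0 x t : p < x -> x < t -> t < q -> 0 < f t - f x.
  by move=> *; rewrite subr_gt0 f_incr.
pose L x : R -> R := (@ln R \o (f - cst (f x))) - (@ln R \o (id - cst x)).
have dL x t : p < x -> x < t -> p < t < q ->
  is_derive t 1 (L x) (f1 t / (f t - f x) - (t - x)^-1).
  move=> px xt /[dup] ptq /andP[_ tq].
  have ? := df ptq.
  have d1 : is_derive t 1 (f - cst (f x)) (f1 t).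
    by apply: is_derive_eq; rewrite subr0.
  have d2 : is_derive t 1 (id - cst x) (1 : R).
    by apply: is_derive_eq; rewrite subr0.
  have l1 : is_derive t 1 (@ln R \o (f - cst (f x))) ((f t - f x)^-1 * f1 t).
    by apply: is_derive1_comp; apply: is_derive1_ln; exact: incr_gt0.
  have l2 : is_derive t 1 (@ln R \o (id - cst x)) ((t - x)^-1 * 1).
    by apply: is_derive1_comp; apply: is_derive1_ln; rewrite subr_gt0.
  rewrite -[X in _ - X]mulr1 [X in X - _]mulrC.
  exact: is_deriveB.
have LE x t : p < x -> x < t -> t < q -> L x t = ln ((f t - f x) / (t - x)).
  by move=> px xt tq; rewrite ln_div// posrE ?subr_gt0// f_incr.
pose M : R -> R := L be - L al.
have : M ga <= M de.
  refine (@nondecreasing_of_derive M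
    (fun t => f1 t / (f t - f be) - (t - be)^-1 -
              (f1 t / (f t - f al) - (t - al)^-1)) _ _ gade _ _).
  - move=> t /in_pq[bt alt tq ptq].
    exact: is_deriveB (dL _ _ pbe bt ptq) (dL _ _ pal alt ptq).
  - move=> t /in_pq[bt alt tq ptq].
    by rewrite subr_ge0 poincare_density_nondecreasing// ltW.
have gq := le_lt_trans gade deq.
have bd := lt_le_trans bega gade.
have ag := lt_trans albe bega.
have ad := lt_trans albe bd.
rewrite /M !fctE !LE// -!ln_div ?posrE ?divr_gt0 ?subr_gt0 ?f_incr//.
by rewrite ler_ln ?posrE ?divr_gt0 ?subr_gt0 ?f_incr// !invf_div.
Qed.

(** [increment_ratio_nondecreasing] says that f does not decrease
(L+M)(M+R)/(MT), which is 1 + LR/(MT). *)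
Lemma sideCr_le_of_derivatives al be ga de :
  p < al -> al < be -> be < ga -> ga < de -> de < q ->
  sideCr al be ga de <= sideCr (f al) (f be) (f ga) (f de).
Proof.
move=> pal albe bega gade deq.
have := increment_ratio_nondecreasing pal albe bega (ltW gade) deq.
have gq := lt_trans gade deq.
have pb := lt_trans pal albe.
have pg := lt_trans pb bega.
have := f_incr pal albe (lt_trans bega gq).
have := f_incr pb bega gq.
have := f_incr pg gade deq.
rewrite /sideCr.
move: (f al) (f be) (f ga) (f de) => A B C D CD BC AB.
have gt0 (x y : R) : x < y -> 0 < y - x by rewrite subr_gt0.
have [ac ad bd] : [/\ al < ga, al < de & be < de] by split; lra.
have [AC AD BD] : [/\ A < C, A < D & B < D] by split; lra.
rewrite !mulf_div ler_pdivrMr ?mulr_gt0 ?gt0//.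
rewrite mulrAC ler_pdivlMr ?mulr_gt0 ?gt0// => H.
rewrite ler_pdivrMr ?mulr_gt0 ?gt0//.
rewrite mulrAC ler_pdivlMr ?mulr_gt0 ?gt0//.
move: H; lra.
Qed.

End Derivatives.
End NonnegSchwarzian.

(** * Images of intervals *)

Section Images.
Context {R : realType}.
Implicit Types (X Y : set R) (f g : R -> R).

(** A derivative that vanishes nowhere is positive when the map is
increasing, so the hypotheses on derivatives of the previous part hold. *)
Lemma nonneg_schwarzian_sideCr_le (p q : R) f (al be ga de : R) :
  nonneg_schwarzian `]p, q[ f ->
  (forall x y, p < x -> x < y -> y < q -> f x < f y) ->
  p < al -> al < be -> be < ga -> ga < de -> de < q ->
  sideCr al be ga de <= sideCr (f al) (f be) (f ga) (f de).
Proof.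
move=> Sf f_incr.
have dk k t : (k < 3)%N -> p < t < q ->
    is_derive t 1 (derive1n k f) (derive1n k.+1 f t).
  move=> k3 ptq; have [|dkf _ _] := Sf t; first by rewrite /= in_itv.
  by rewrite derive1nS derive1E; apply: derivableP; exact: dkf.
have df t : p < t < q -> is_derive t 1 f (derive1n 1 f t) by exact: (dk 0).
have df1 t : p < t < q -> is_derive t 1 (derive1n 1 f) (derive1n 2 f t).
  exact: (dk 1).
have df2 t : p < t < q -> is_derive t 1 (derive1n 2 f) (derive1n 3 f t).
  exact: (dk 2).
have f1_gt0 t : p < t < q -> 0 < derive1n 1 f t.
  move=> ptq; have [|_ f1n0 _] := Sf t; first by rewrite /= in_itv.
  rewrite lt0r f1n0 /=.
  apply: (@incr_derive1_ge0_itv R f false true p q).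
  + move=> x; rewrite inE/= in_itv/= => /df dfx; exact: ex_derive.
  + move=> x y; rewrite !in_itv/= => /andP[px _] /andP[_ yq] xy.
    exact: f_incr.
  + by rewrite in_itv.
have S_ge0 t : p < t < q -> 0 <= derive1n 3 f t / derive1n 1 f t
    - 3 / 2 * (derive1n 2 f t / derive1n 1 f t) ^+ 2.
  by move=> ptq; have [|_ _] := Sf t; first by rewrite /= in_itv.
exact: (sideCr_le_of_derivatives df df1 df2 f1_gt0 S_ge0 f_incr).
Qed.

Lemma increasing_homeo_image X Y f (x y : R) : is_interval X ->
  increasing_homeo X Y f -> X x -> X y -> x < y ->
  f @` `]x, y[ = `]f x, f y[%classic.
Proof.
move=> iX [_ f_incr cf _] Xx Xy xy.
have sub : `[x, y] `<=` X.
  by move=> t /=; rewrite in_itv/=; exact: iX.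
have homo s t : x <= s -> s < t -> t <= y -> f s < f t.
  move=> xs st ty; apply: f_incr => //; rewrite inE; apply: sub;
    rewrite /= in_itv/=.
    by rewrite xs (le_trans (ltW st)).
  by rewrite ty (le_trans xs (ltW st)).
apply/seteqP; split=> [_ [t + <-]|z] /=; rewrite !in_itv/=.
  by move=> /andP[xt ty]; rewrite !homo// ltW.
move=> /andP[xz zy]; have fxy := homo _ _ (lexx x) xy (lexx y).
have cxy := continuous_subspaceW sub cf.
have [|t] := IVT (ltW xy) cxy (v := z).
  by rewrite min_l ?max_r ?ltW// (ltW xz) ltW.
rewrite in_itv/= => /andP[xt ty] ftz; exists t => //.
rewrite in_itv/= !lt_neqAle xt ty !andbT; apply/andP; split.
  by apply: contraTneq xz => ->; rewrite ftz ltxx.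
by apply: contraTneq zy => <-; rewrite ftz ltxx.
Qed.

(** The form of being an increasing homeomorphism onto the image that is stable
under composition without any topology: the second clause stands for
continuity. *)
Definition interval_embedding (a d : R) g : Prop :=
  (forall x y, a < x -> x < y -> y < d -> g x < g y) /\
  (forall x y, a < x -> x < y -> y < d ->
     g @` `]x, y[ = `]g x, g y[%classic).

Lemma interval_embedding_interval a d g : interval_embedding a d g ->
  is_interval (g @` `]a, d[).
Proof.
move=> [gincr gim] _ _ [x + <-] [y + <-] z; rewrite /= !in_itv/=.
move=> /andP[ax xd] /andP[ay yd].
rewrite !le_eqVlt => /andP[/predU1P[<- _|xz]].
  by exists x => //=; rewrite in_itv/= ax.
move=> /predU1P[->|zy]; first by exists y => //=; rewrite in_itv/= ay.
have xy : x < y.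
  rewrite ltNge le_eqVlt; apply/negP => /predU1P[yx|yx].
    by move: (lt_trans xz zy); rewrite yx ltxx.
  by have := lt_trans (lt_trans xz zy) (gincr _ _ ay yx xd); rewrite ltxx.
have : (`]g x, g y[%classic) z by rewrite /= in_itv/= xz.
rewrite -gim// => -[t]; rewrite /= in_itv/= => /andP[xt ty] <-.
by exists t => //=; rewrite in_itv/= (lt_trans ax xt) (lt_trans ty yd).
Qed.

Lemma interval_embedding_comp a d f g Y : interval_embedding a d g ->
  increasing_homeo (g @` `]a, d[) Y f -> interval_embedding a d (f \o g).
Proof.
move=> gemb fh; have iX := interval_embedding_interval gemb.
have [gincr gim] := gemb; have [_ fincr _ _] := fh.
have Xg x : a < x -> x < d -> (g @` `]a, d[) (g x).
  by move=> ax xd; exists x => //=; rewrite in_itv/= ax.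
split=> x y ax xy yd.
  apply: fincr; rewrite ?inE; [apply: Xg|apply: Xg|exact: gincr] => //.
    exact: lt_trans yd.
  exact: lt_trans xy.
have xd := lt_trans xy yd; have ay := lt_trans ax xy.
rewrite -image_comp gim//; apply: (increasing_homeo_image iX fh) => //.
- exact: Xg.
- exact: Xg.
- exact: gincr.
Qed.

Lemma ilength_itvoo (x y : R) : x < y -> ilength `]x, y[ = y - x.
Proof. by move=> xy; rewrite /ilength sup_itv ?inf_itv// bnd_simp. Qed.

Lemma sideCr_gt0 (al be ga de : R) : al < be -> be < ga -> ga < de ->
  0 < sideCr al be ga de.
Proof. by move=> *; rewrite /sideCr divr_gt0// mulr_gt0// subr_gt0; lra. Qed.

(** On images of intervals, rho is a difference quotient, and the quotient of
rho's in [cross_ratio_distortions] is the ratio of the values of [sideCr]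
after and before f. *)
Lemma sideCr_ge_distortion X Y f (c al be ga de : R) : is_interval X ->
  increasing_homeo X Y f ->
  lbound (cross_ratio_distortions X f) c%:E ->
  X al -> X be -> X ga -> X de -> al < be -> be < ga -> ga < de ->
  expR c * sideCr al be ga de <= sideCr (f al) (f be) (f ga) (f de).
Proof.
move=> iX fh cX Xal Xbe Xga Xde ab bg gd.
have [_ fincr _ _] := fh.
have ag := lt_trans ab bg; have bd := lt_trans bg gd.
have ad := lt_trans ab bd.
have fi x y : X x -> X y -> x < y -> f x < f y.
  by move=> Xx Xy xy; apply: fincr; rewrite ?inE.
have im x y : X x -> X y -> x < y -> rho x y f = (f y - f x) / (y - x).
  move=> Xx Xy xy; rewrite /rho (increasing_homeo_image iX fh)//.
  by rewrite !ilength_itvoo//; exact: fi.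
have fab := fi _ _ Xal Xbe ab; have fbg := fi _ _ Xbe Xga bg.
have fgd := fi _ _ Xga Xde gd.
set D := rho al be f * rho ga de f / (rho al de f * rho be ga f).
have DE : D = sideCr (f al) (f be) (f ga) (f de) / sideCr al be ga de.
  rewrite /D !im// /sideCr; field.
  by rewrite !subr_eq0 !gt_eqF// fi.
have D0 : 0 < D by rewrite DE divr_gt0// sideCr_gt0.
have : expR c <= D.
  rewrite -ler_ln ?posrE ?expR_gt0// expRK -lee_fin; apply: cX.
  by exists al, be, ga, de.
by rewrite DE ler_pdivlMr// sideCr_gt0.
Qed.

End Images.

(** * Cross-ratios along a standard composition *)

Section Composition.
Context {R : realType}.
Implicit Types (f : R -> R) (h s : nat -> R -> R).

Lemma comp_upto_embedding (m : nat) (a d : R) h s (k : nat) :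
  standard_composition m a d h s -> (k <= m)%N ->
  interval_embedding a d (comp_upto h s k).
Proof.
move=> std; elim: k => [_|k IHk km].
  by split=> // x y *; rewrite image_id.
have [_ hh hs _ _] := std k km.
have g_emb := IHk (ltnW km).
have hg_emb := interval_embedding_comp g_emb hh.
apply: (interval_embedding_comp (Y := hdom a d h s k.+1) hg_emb).
by rewrite -image_comp.
Qed.

Lemma sideCr_ge_comp_upto (m : nat) (a d : R) h s (c : nat -> R)
    (al be ga de : R) :
  standard_composition m a d h s ->
  (forall i, (i < m)%N ->
    lbound (cross_ratio_distortions (hdom a d h s i) (h i)) (c i)%:E) ->
  a < al -> al < be -> be < ga -> ga < de -> de < d ->
  forall k, (k <= m)%N ->
  let f := comp_upto h s k in
  expR (\sum_(i < k) c i) * sideCr al be ga de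
    <= sideCr (f al) (f be) (f ga) (f de).
Proof.
move=> std cb aal ab bg gd ded; elim=> [_|k IHk km] /=.
  by rewrite big_ord0 expR0 mul1r.
have /= IH := IHk (ltnW km).
have [_ hh hs Ss _] := std k km.
have g_emb := comp_upto_embedding std (ltnW km).
have hg_emb := interval_embedding_comp g_emb hh.
rewrite big_ord_recr/= addrC expRD -mulrA.
have [g_incr _] := g_emb; have [hg_incr _] := hg_emb.
set g := comp_upto h s k in IH g_emb hg_emb g_incr hg_incr *.
have [aga ade gad] : [/\ a < ga, a < de & ga < d] by split; lra.
have [abe bed ald] : [/\ a < be, be < d & al < d] by split; lra.
have Xg x : a < x -> x < d -> hdom a d h s k (g x).
  by move=> ax xd; exists x => //=; rewrite in_itv/= ax.
apply: le_trans (ler_wpM2l (expR_ge0 _) IH) _.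
apply: le_trans (sideCr_ge_distortion (interval_embedding_interval g_emb) hh
  (cb k km) (Xg _ aal ald) (Xg _ abe bed) (Xg _ aga gad) (Xg _ ade ded)
  _ _ _) _;
  try exact: g_incr.
(* The Schwarzian estimate needs an open interval around the four points, so
   (al, de) is enlarged a little inside (a, d). *)
pose al' := (a + al) / 2; pose de' := (de + d) / 2.
have [aal' al'al] : a < al' /\ al' < al by rewrite /al'; split; lra.
have [dede' de'd] : de < de' /\ de' < d by rewrite /de'; split; lra.
have sub x : (h k \o g) al' < x -> x < (h k \o g) de' -> sdom a d h s k x.
  have [_ im] := hg_emb.
  have al'de' : al' < de' by lra.
  move=> px xq; have : (`](h k \o g) al', (h k \o g) de'[%classic) x.
    by rewrite /= in_itv/= px.
  rewrite -im// => -[t] /=; rewrite in_itv/= => /andP[t1 t2] <-.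
  exists (g t) => //; apply: Xg; lra.
have [_ s_incr _ _] := hs.
apply: (@nonneg_schwarzian_sideCr_le R ((h k \o g) al') ((h k \o g) de')).
- by move=> x; rewrite /= in_itv/= => /andP[px xq]; apply: Ss; exact: sub.
- move=> x y px xy yq; apply: s_incr => //; rewrite inE; apply: sub => //.
    exact: lt_trans yq.
  exact: lt_trans xy.
- by apply: hg_incr => //; lra.
- exact: hg_incr.
- exact: hg_incr.
- exact: hg_incr.
- by apply: hg_incr => //; lra.
Qed.

(** * Distortion of a restriction *)

(** The factors of the midpoint cancel in the cross-ratio. *)
Lemma poincare_modelE (x y z : R) : x < z -> z < y ->
  poincare_model `]x, y[ z = ln ((z - x) / (y - z)).
Proof.
move=> xz zy; have xy := lt_trans xz zy.
rewrite /poincare_model sup_itv ?inf_itv ?bnd_simp// /Cr.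
have [zx0 yz0] : 0 < z - x /\ 0 < y - z by rewrite !subr_gt0.
have mx : (x + y) / 2 - x = (y - x) / 2 by field.
have my : y - (x + y) / 2 = (y - x) / 2 by field.
rewrite mx my -lnV; last first.
  by rewrite posrE divr_gt0// mulr_gt0// divr_gt0// subr_gt0.
by congr ln; field; rewrite !gt_eqF ?subr_gt0.
Qed.

Lemma poincare_model_surj (x y : R) : x < y ->
  set_surj `]x, y[ [set: R] (poincare_model `]x, y[).
Proof.
move=> xy t _; have e0 := expR_gt0 t.
pose z := (x + y * expR t) / (1 + expR t).
have e1 : 1 + expR t != 0 by rewrite gt_eqF// addr_gt0.
have zx : z - x = (y - x) * expR t / (1 + expR t) by rewrite /z; field.
have yz : y - z = (y - x) / (1 + expR t) by rewrite /z; field.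
have yx0 : 0 < y - x by rewrite subr_gt0.
have xz : x < z by rewrite -subr_gt0 zx divr_gt0 ?mulr_gt0// addr_gt0.
have zy : z < y by rewrite -subr_gt0 yz divr_gt0// addr_gt0.
exists z; first by rewrite /= in_itv/= xz.
rewrite poincare_modelE// zx yz.
rewrite (_ : _ / _ = expR t) ?expRK//; field.
by rewrite e1 gt_eqF.
Qed.

(** Every real number is the Poincare coordinate of some x in (b,c), so the
supremum over the line is a supremum over (b,c). *)
Lemma distortion_le (b c : R) f (M : R) : b < c ->
  f @` `]b, c[ = `]f b, f c[%classic ->
  (forall x, b < x -> x < c -> f b < f x /\ f x < f c) ->
  (forall x, b < x -> x < c ->
     `|ln ((f x - f b) / (f c - f x)) - ln ((x - b) / (c - x))| <= M) ->
  (distortion `]b, c[ f <= M%:E)%E.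
Proof.
move=> bc fim fx fM; apply: ge_ereal_sup => _ [t _ <-].
rewrite lee_fin /poincare fim /=.
have bcS := poincare_model_surj bc.
set x := pinv _ _ t.
have xt : poincare_model `]b, c[ x = t.
  by apply: (surjpK _ bcS); rewrite inE.
have : (`]b, c[%classic) x.
  by apply: (surjpinv_image_sub bcS); exists t.
rewrite /= in_itv/= => /andP[bx xc].
have [fbx fxc] := fx _ bx xc.
by rewrite -xt !poincare_modelE//; exact: fM.
Qed.

(** The distortion of [sideCr] on (b,x,c,d') compares rho(b,x)/rho(x,c) with
rho(b,d')/rho(c,d'), which is at least (d'-c)/(d'-b); likewise on (a',b,x,c)
for the opposite inequality. *)
Lemma distortion_le_of_sideCr (a b c d D : R) f :
  a < b -> b < c -> c < d -> D <= 0 ->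
  interval_embedding a d f ->
  (forall al be ga de, a < al -> al < be -> be < ga -> ga < de -> de < d ->
    expR D * sideCr al be ga de <= sideCr (f al) (f be) (f ga) (f de)) ->
  (distortion `]b, c[ f <= `|D + ln (Cr a b c d)|%:E)%E.
Proof.
move=> ab bc cd D0 [f_incr fim] fD.
have [ac bd] : a < c /\ b < d by split; lra.
have [cb0 ca0 db0] : [/\ 0 < c - b, 0 < c - a & 0 < d - b] by split; lra.
have [ba0 dc0] : 0 < b - a /\ 0 < d - c by split; lra.
have Cr0 : 0 < Cr a b c d by rewrite divr_gt0 ?mulr_gt0.
have lnCr : ln (Cr a b c d) <= 0.
  apply: ln_le0; rewrite ler_pdivrMr ?mulr_gt0// mul1r.
  by apply: ler_pM; lra.
have le0 : D + ln (Cr a b c d) <= 0 by rewrite -(addr0 0) lerD.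
apply: distortion_le => //; first exact: fim.
  by move=> x bx xc; split; apply: f_incr; lra.
move=> x bx xc.
have xb0 : 0 < x - b by rewrite subr_gt0.
have cx0 : 0 < c - x by rewrite subr_gt0.
have fbx : 0 < f x - f b by rewrite subr_gt0; apply: f_incr; lra.
have fxc : 0 < f c - f x by rewrite subr_gt0; apply: f_incr; lra.
set r := (f x - f b) / (f c - f x); set r0 := (x - b) / (c - x).
have r_gt0 : 0 < r by rewrite divr_gt0.
have r0_gt0 : 0 < r0 by rewrite divr_gt0.
have lower : expR D * Cr a b c d * r0 <= r.
  (* This d' solves (d' - c) / (d - b) = Cr a b c d, and d' - b < d - b. *)
  pose d' := c + (b - a) * (d - c) / (c - a).
  have cd' : c < d' by rewrite /d' ltrDl divr_gt0// mulr_gt0.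
  have d'd : d' < d.
    rewrite /d' -ltrBrDl ltr_pdivrMr// mulrC ltr_pM2l//; lra.
  have fcd' : 0 < f d' - f c by rewrite subr_gt0; apply: f_incr; lra.
  have := fD b x c d' ab bx xc cd' d'd.
  have -> : sideCr b x c d' = r0 * ((d' - c) / (d' - b)).
    by rewrite /sideCr /r0 mulf_div (mulrC (c - x)).
  have -> : sideCr (f b) (f x) (f c) (f d') =
      r * ((f d' - f c) / (f d' - f b)).
    by rewrite /sideCr /r mulf_div (mulrC (f c - f x)).
  have k1 : (f d' - f c) / (f d' - f b) <= 1.
    rewrite ler_pdivrMr ?mul1r; lra.
  have k2 : Cr a b c d <= (d' - c) / (d' - b).
    rewrite ler_pdivlMr ?subr_gt0; last lra.
    have -> : Cr a b c d * (d' - b) = (d' - c) * ((d' - b) / (d - b)).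
      by rewrite /Cr /d'; field; rewrite !gt_eqF.
    rewrite ler_piMr ?subr_ge0 ?ltW//.
    by rewrite ltr_pdivrMr// mul1r ltrD2r.
  move=> H; apply: le_trans (le_trans _ H) _; last by rewrite ger_pMr.
  by rewrite -mulrA ler_pM2l ?expR_gt0// mulrC ler_pM2l.
have upper : expR D * Cr a b c d * r <= r0.
  (* The mirror image: (b - a') / (c - a) = Cr a b c d, and c - a' < c - a. *)
  pose a' := b - (b - a) * (d - c) / (d - b).
  have a'b : a' < b by rewrite /a' ltrBlDr ltrDl divr_gt0// mulr_gt0.
  have aa' : a < a'.
    by rewrite /a' ltrBrDr -ltrBrDl ltr_pdivrMr// ltr_pM2l//; lra.
  have fa'b : 0 < f b - f a' by rewrite subr_gt0; apply: f_incr; lra.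
  have := fD a' b x c aa' a'b bx xc cd.
  have -> : sideCr a' b x c = r0^-1 * ((b - a') / (c - a')).
    by rewrite /sideCr /r0 invf_div mulf_div; congr (_ / _); exact: mulrC.
  have -> : sideCr (f a') (f b) (f x) (f c) =
      r^-1 * ((f b - f a') / (f c - f a')).
    by rewrite /sideCr /r invf_div mulf_div; congr (_ / _); exact: mulrC.
  have k1 : (f b - f a') / (f c - f a') <= 1.
    rewrite ler_pdivrMr ?mul1r; lra.
  have k2 : Cr a b c d <= (b - a') / (c - a').
    rewrite ler_pdivlMr ?subr_gt0; last lra.
    have -> : Cr a b c d * (c - a') = (b - a') * ((c - a') / (c - a)).
      by rewrite /Cr /a'; field; rewrite !gt_eqF.
    rewrite ler_piMr ?subr_ge0 ?ltW//.
    by rewrite ltr_pdivrMr// mul1r ltrD2l ltrN2.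
  move=> H; rewrite -ler_pdivlMr// -ler_pdivrMl// mulrC.
  apply: le_trans (le_trans _ H) _; last by rewrite ger_pMr ?invr_gt0.
  by rewrite -mulrA ler_pM2l ?expR_gt0// mulrC ler_pM2l ?invr_gt0.
have E0 : 0 < expR D by exact: expR_gt0.
have EC0 : 0 < expR D * Cr a b c d by rewrite mulr_gt0.
have lnE w : 0 < w -> ln (expR D * Cr a b c d * w) =
    D + ln (Cr a b c d) + ln w.
  by move=> w0; rewrite (lnM EC0 w0) (lnM E0 Cr0) expRK.
rewrite (ler0_norm le0) ler_norml opprK.
move: lower upper; rewrite -ler_ln ?posrE ?(mulr_gt0 EC0)// (lnE _ r0_gt0).
rewrite -[_ * r <= r0]ler_ln ?posrE ?(mulr_gt0 EC0)// (lnE _ r_gt0).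
by move=> ? ?; apply/andP; split; lra.
Qed.

End Composition.

Theorem mainTheorem1 (R : realType) :
  exists Q : R, forall (m : nat) (a d : R) (h s : nat -> R -> R),
    standard_composition m a d h s ->
    forall b c : R, a < b -> b < c -> c < d ->
    (distortion `]b, c[%classic (comp_upto h s m)
     <= Q%:E * d2 m a d h s * expeR `|d1 m a d h s|
          * (Num.min 1 ((c - b) / Num.min (b - a) (d - c)))%:E
        + d2 m a d h s
        + 2%:E * `|d1 m a d h s + (ln (Cr a b c d))%:E|)%E.
Proof.
exists 0 => m a d h s std b c ab bc cd.
rewrite !mul0e add0e; apply: le_trans (leeDr _ (d2_ge0 m a d h s)).
pose S i := [set 0%E] `|` cross_ratio_distortions (hdom a d h s i) (h i).
have d1E : d1 m a d h s = (\sum_(i < m) ereal_inf (S i))%E by [].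
have S_le0 i : (ereal_inf (S i) <= 0)%E by apply: ereal_inf_lbound; left.
have [/esum_eqNyP|d1Ny] := eqVneq (d1 m a d h s) -oo%E.
  (* An infinite summand makes the right-hand side infinite. *)
  move=> [i [_ _ iNy]].
  have -> : d1 m a d h s = -oo%E by apply/esum_eqNyP; exists i; split.
  by rewrite addNye /= mulry gtr0_sg ?mul1e ?leey.
have S_fin i : (i < m)%N -> ereal_inf (S i) \is a fin_num.
  move=> im; rewrite fin_numE; apply/andP; split.
    apply: contraNneq d1Ny => iNy; apply/eqP/esum_eqNyP.
    by exists (Ordinal im); split.
  by rewrite lt_eqF// (le_lt_trans (S_le0 i))// ltry.
pose cc i := fine (ereal_inf (S i)).
have d1cc : d1 m a d h s = (\sum_(i < m) cc i)%:E.
  rewrite d1E -sumEFin; apply: eq_bigr => i _.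
  by rewrite fineK// S_fin.
have cc_le0 i : cc i <= 0 by exact: fine_le0.
have cclb i : (i < m)%N ->
    lbound (cross_ratio_distortions (hdom a d h s i) (h i)) (cc i)%:E.
  by move=> im e Se; rewrite fineK ?S_fin//; apply: ereal_inf_lbound; right.
have emb := comp_upto_embedding std (leqnn m).
have D0 : \sum_(i < m) cc i <= 0 by apply: sumr_le0.
apply: (@le_trans _ _ `|\sum_(i < m) cc i + ln (Cr a b c d)|%:E).
  apply: distortion_le_of_sideCr => // al be ga de aal albe bega gade ded.
  exact: (sideCr_ge_comp_upto std cclb aal albe bega gade ded (leqnn m)).
rewrite d1cc -EFinD abse_EFin -EFinM lee_fin ler_peMl//.
by rewrite (ler_nat _ 1 2).
Qed.
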